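(* Let $\lambda_0y+\gamma_0$ be the tangent of the function $y\mapsto\ln\Phi^{-1}(y)$ at $y=\Phi(1)$, and for $n\in\mathcal N\setminus\{0\}$ let $\lambda_ny+\gamma_n$ be the line obtained by connecting, in sequence, the two adjacent points $(y^{(n-1)},\ln\Phi^{-1}(y^{(n-1)}))$ and $(y^{(n)},\ln\Phi^{-1}(y^{(n)}))$ on the graph of that function. Then in the domain of the function $\ln\Phi^{-1}(y_j)$, i.e., for $y_j>0.5$, we have $$\ln\Phi^{-1}(y_j)\le\max_{n\in\mathcal N}\{\lambda_ny_j+\gamma_n\},\qquad\forall j\in\mathcal J.$$ Moreover, the piecewise linear function $y_j\mapsto\max_{n\in\mathcal N}\{\lambda_ny_j+\gamma_n\}$ is convex, because its epigraph is a convex polyhedron.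
   Context: $\Phi$ denotes the cumulative distribution function of the standard normal distribution and $\Phi^{-1}:(0,1)\to\mathbb R$ its inverse; $\ln$ is the natural logarithm. The function $\ln\Phi^{-1}$ is defined where $\Phi^{-1}$ is positive, i.e., for arguments greater than $0.5$ (and less than $1$, where $\Phi^{-1}$ is defined). $\mathcal N=\{0,1,\dots,N\}$ is the index set of the lines, and $\Phi(1)=y^{(0)}<y^{(1)}<\cdots<y^{(N)}$ are the abscissae of $N+1$ selected points on the graph of $\ln\Phi^{-1}$. $\mathcal J$ is a finite index set (of the components of a Gaussian mixture), and $y_j$, $j\in\mathcal J$, are real variables.
   Formalization: The inequality is stated only for 0.5 < y_j ≤ y^(N): for y^(N) < y_j < 1 it fails, since ln Φ^{-1} is strictly convex on [Φ(1),1) and so lies strictly above the tangent and all extrapolated chords there. *)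

(* Defs.v *)
From HB Require Import structures.
From mathcomp Require Import all_boot all_order all_algebra.
From mathcomp Require Import all_classical all_reals all_analysis.
Set Implicit Arguments.
Unset Strict Implicit.
Unset Printing Implicit Defensive.
Import Order.TTheory GRing.Theory Num.Theory.
Import numFieldNormedType.Exports.
Local Open Scope classical_set_scope.
Local Open Scope ring_scope.

Section StandardNormal.
Context {R : realType}.

Definition Phi (x : R) : R :=
  fine (normal_prob (0 : R) (1 : R) `]-oo, x]).

(* Inverse of Phi : R -> ]0, 1[; the value outside of ]0, 1[, which is the
   image of Phi, is the junk value 0. *)
Definition Phi_inv : R -> R := 'pinv_(fun=> 0) [set: R] Phi.

(* The mathematical domain is `]1/2, 1[, where Phi_inv is positive; elsewhere
   the library's [ln] returns 0. *)
Definition ln_Phi_inv (y : R) : R := ln (Phi_inv y).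

End StandardNormal.

Section Lines.
Context {R : realType} (N : nat) (pts : 'I_N.+1 -> R).

(* [inord n.-1] is the index n - 1; it is only used when n != ord0. *)
Definition line_slope (n : 'I_N.+1) : R :=
  if n == ord0 then derive1 (@ln_Phi_inv R) (pts ord0)
  else (ln_Phi_inv (pts n) - ln_Phi_inv (pts (inord n.-1)))
         / (pts n - pts (inord n.-1)).

(* Every line, tangent or chord, passes through its point of index n. *)
Definition line_intercept (n : 'I_N.+1) : R :=
  ln_Phi_inv (pts n) - line_slope n * pts n.

Definition line (n : 'I_N.+1) (y : R) : R :=
  line_slope n * y + line_intercept n.

(* The default value of the big operator belongs to the family, so this is
   the maximum over 'I_N.+1. *)
Definition max_line (y : R) : R :=
  \big[Num.max/line ord0 y]_(n < N.+1) line n y.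

End Lines.

Section Epigraph.
Context {R : realType}.

Definition epigraph (f : R -> R) : set (R * R) := [set p | f p.1 <= p.2].

Definition convex_polyhedron (S : set (R * R)) : Prop :=
  exists (m : nat) (a : 'I_m -> R * R) (c : 'I_m -> R),
    (forall i, a i != 0) /\
    S = [set p | forall i, (a i).1 * p.1 + (a i).2 * p.2 <= c i].

End Epigraph.

(* Main.v *)
Require Import Defs.
From HB Require Import structures.
From mathcomp Require Import all_boot all_order all_algebra.
From mathcomp Require Import all_classical all_reals all_analysis.
From mathcomp Require Import ring lra.
Import Order.TTheory GRing.Theory Num.Theory.
Import numFieldNormedType.Exports.
Local Open Scope classical_set_scope.
Local Open Scope ring_scope.

(** Write [pdf] for the standard normal density. In the coordinate [x] with
[y = Phi x], the function [ln \o Phi_inv] is [ln x], and its derivative with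
respect to [y] is [1 / (x * pdf x)]. The product [x * pdf x] increases for
[0 < x <= 1] and decreases for [1 <= x], so the slope decreases and then
increases: [ln \o Phi_inv] is concave for [1/2 < y <= Phi 1] and convex for
[Phi 1 <= y < 1]. Where it is concave it is below its tangent at [Phi 1], and
where it is convex it is below each chord between the endpoints of the chord.
Each argument [y] that is at most the last abscissa is in one of these
situations, so one of the lines is an upper bound there.

Only the resulting inequalities are needed, not concavity and convexity.
Cauchy's mean value theorem applied to [Phi] and [ln] ([Phi_ln_MVT]) expresses
the quotient of an increment of [Phi] by that of [ln] as a value
[t * pdf t]. Bounding it by its maximum, reached at [1] ([xpdf_max]), gives
the tangent inequality [ln_le_tangent]; comparing its values on two consecutive
intervals ([xpdf_nincr]) gives the chord inequality [ln_le_chord]. Neither of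
them mentions [Phi_inv], which is differentiated only for the slope of the
tangent.

That each [y] with [1/2 < y < 1] is [Phi x] for some [x > 0]
([Phi_gt0_surj]) follows from the intermediate value theorem, as
[Phi 0 = 1/2] by symmetry and [Phi] tends to [1] at infinity. The statements on
the maximum hold for any finite family of lines: the epigraph is an
intersection of half-planes, and each line is affine and below the maximum. *)

(** * The standard normal distribution function *)

Section StandardNormalCdf.
Set Implicit Arguments.
Unset Strict Implicit.
Context {R : realType}.
Implicit Types x y s t a b : R.

Local Notation mu := (@lebesgue_measure R).
Local Notation pdf := (normal_pdf (0 : R) (1 : R)).

Lemma pdfE x : pdf x = normal_peak 1 * expR (- x ^+ 2 / 2).
Proof. by rewrite normal_pdfE// /normal_fun subr0 expr1n. Qed.

Lemma pdf_gt0 x : 0 < pdf x.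
Proof. by rewrite pdfE mulr_gt0 ?expR_gt0// normal_peak_gt0. Qed.

Lemma continuous_pdf : continuous pdf.
Proof. exact: continuous_normal_pdf. Qed.

(** The density is continuous and integrable near [-oo], so the fundamental
theorem of calculus applies to the improper integral defining [Phi]. *)
Lemma is_derive_Phi x : is_derive x 1 (@Phi R) (pdf x).
Proof.
have [||||dP PE] := @continuous_FTC1 R pdf -oo%O x (x + 1).
- by rewrite ltrDl.
- apply: integrableS (integrable_normal_pdf 0 1) => //.
- by rewrite ltNyr.
- exact: continuous_pdf.
by apply: DeriveDef; rewrite -?derive1E.
Qed.

Lemma continuous_Phi : continuous (@Phi R).
Proof.
move=> x; apply/differentiable_continuous/derivable1_diffP.
exact: (@ex_derive _ _ _ _ _ _ _ (is_derive_Phi x)).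
Qed.

Lemma ler_Phi : {mono (@Phi R) : x y / x <= y}.
Proof.
apply: le_mono => x y xy.
have [z _ PE] := MVT xy (fun z _ => is_derive_Phi z)
  (continuous_subspaceT continuous_Phi).
by rewrite -subr_gt0 PE mulr_gt0 ?pdf_gt0 ?subr_gt0.
Qed.

Lemma ltr_Phi : {mono (@Phi R) : x y / x < y}.
Proof. exact: leW_mono ler_Phi. Qed.

Lemma Phi_inj : injective (@Phi R).
Proof. exact: inc_inj ler_Phi. Qed.

Lemma Phi_invK : cancel (@Phi R) Phi_inv.
Proof.
by move=> x; apply: pinvKV; rewrite ?inE// => u v _ _; exact: Phi_inj.
Qed.

Lemma Phi_EFin x : (Phi x)%:E = normal_prob (0 : R) 1 `]-oo, x].
Proof. by rewrite fineK// fin_num_measure. Qed.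

(** The density is even, so half of its total mass [1] lies on each side of
[0]. *)
Lemma Phi0 : Phi (0 : R) = 2^-1.
Proof.
have even : pdf =1 pdf \o -%R by move=> x; rewrite /= !pdfE sqrrN.
have := ge0_symfun_integralT (normal_pdf_ge0 0 1) continuous_pdf even.
suff -> : (\int[mu]_(x in [set x : R | (0 <= x)%R]) (pdf x)%:E = (Phi 0)%:E)%E.
  by rewrite integral_normal_pdf -EFinM => -[] ?; lra.
rewrite Phi_EFin /normal_prob -set_itvcy.
have := @ge0_integration_by_substitutionNy R pdf 0; rewrite oppr0 => ->.
- by apply: eq_integral => x _; rewrite even.
- exact: continuous_subspaceT continuous_pdf.
- by move=> x _; exact: normal_pdf_ge0.
Qed.

(* [Phi] is the cumulative distribution function of the identity, viewed as a
   random variable on the line with the normal law. *)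
Let idTR : measurableTypeR R -> R := idfun.

#[local] HB.instance Definition _ :=
  @isMeasurableFun.Build _ _ _ _ idTR (@measurable_id _ _ setT).

Lemma Phi_cvgy1 : Phi x @[x --> +oo] --> (1 : R).
Proof.
apply: fine_cvg.
exact: (cvg_cdfy1 (idTR : {RV normal_prob (0 : R) 1 >-> R})).
Qed.

(** The preimage is positive because [Phi 0] is exactly [1/2]; elsewhere [ln x]
would be a default value. *)
Lemma Phi_gt0_surj y : 2^-1 < y -> y < 1 -> exists2 x, 0 < x & Phi x = y.
Proof.
move=> y2 y1.
have [b b0 yb] : exists2 b, 0 < b & y < Phi b.
  near (pinfty_nbhs R) => b; exists b; first by near: b; exact: nbhs_pinfty_gt.
  by near: b; apply: (cvgr_gt _ Phi_cvgy1).
have [||x _ Pxy] := @IVT R Phi 0 b y (ltW b0).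
- exact: continuous_subspaceT continuous_Phi.
- by rewrite Phi0 ge_min le_max (ltW y2) (ltW yb) orbT.
by exists x => //; rewrite -ltr_Phi Phi0 Pxy.
Unshelve. all: end_near. Qed.

(** * Comparing the increments of [Phi] and [ln] *)

(** Cauchy's mean value theorem: the ratio of the derivatives [pdf t] and
[1 / t] is [t * pdf t]. *)
Lemma Phi_ln_MVT a b : 0 < a -> a < b ->
  exists2 t, a < t < b & Phi b - Phi a = (t * pdf t) * (ln b - ln a).
Proof.
move=> a0 ab.
have pos x : a <= x -> 0 < x by exact: lt_le_trans.
have lnab : ln b - ln a != 0.
  by rewrite subr_eq0 gt_eqF// ltr_ln// posrE ?pos// ltW.
have [||x _|x|x|t] :=
    @cauchy_MVT R Phi pdf (@ln R) (fun x => x^-1) a b ab.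
- exact: continuous_subspaceT continuous_Phi.
- apply: continuous_in_subspaceT => x; rewrite inE/= in_itv/= => /andP[ax _].
  exact/continuous_ln/pos.
- exact: is_derive_Phi.
- by rewrite in_itv/= => /andP[/ltW/pos x0 _]; exact: is_derive1_ln.
- by rewrite in_itv/= => /andP[/ltW/pos x0 _]; rewrite invr_eq0 gt_eqF.
rewrite in_itv/= invrK => tab tE; exists t => //.
by rewrite [t * _]mulrC tE divfK.
Qed.

(** The ratio [pdf s / pdf t] is [expR ((t ^+ 2 - s ^+ 2) / 2)], which is at
least [1 + (t ^+ 2 - s ^+ 2) / 2]. The hypothesis says exactly that [s] times
this lower bound is at least [t]. It covers both regimes used below: [s] is the
maximizer [1], or [1 <= s <= t]. *)
Lemma xpdf_le s t : 0 < s -> 0 <= (t - s) * (s * (s + t) - 2) ->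
  t * pdf t <= s * pdf s.
Proof.
move=> s0 st.
have -> : pdf s = pdf t * expR ((t ^+ 2 - s ^+ 2) / 2).
  by rewrite !pdfE -mulrA -expRD; congr (_ * expR _); field.
rewrite mulrCA mulrC ler_wpM2l// ?(ltW (pdf_gt0 _))//.
rewrite (le_trans _ (ler_wpM2l (ltW s0) (expR_ge1Dx _)))//.
by rewrite -subr_ge0; nra.
Qed.

Lemma xpdf_max t : t * pdf t <= pdf 1.
Proof.
rewrite -[leRHS]mul1r; apply: xpdf_le => //.
by rewrite (_ : _ * _ = (t - 1) ^+ 2) ?sqr_ge0//; ring.
Qed.

Lemma xpdf_nincr s t : 1 <= s -> s <= t -> t * pdf t <= s * pdf s.
Proof.
move=> s1 st; apply: xpdf_le; first by lra.
by rewrite mulr_ge0 ?subr_ge0//; nra.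
Qed.

(** Between [x] and [1], [Phi] increases by [t * pdf t] times the increment of
[ln] for some [t], hence by at most [pdf 1] times it. *)
Lemma ln_le_tangent x : 0 < x -> x <= 1 -> ln x <= (Phi x - Phi 1) / pdf 1.
Proof.
move=> x0; rewrite le_eqVlt => /predU1P[->|x1].
  by rewrite ln1 subrr mul0r.
have [t _ tE] := Phi_ln_MVT x0 x1.
have lnx : ln x <= 0 by rewrite ln_le0 ?ltW.
have := xpdf_max t.
rewrite ler_pdivlMr ?pdf_gt0//; move: tE; rewrite ln1 => tE tm; nra.
Qed.

(** On both sides of [x], the increment of [Phi] is a value of [t * pdf t] times
that of [ln], and the factor is larger on the left. So [ln], as a function of
[Phi], has a smaller mean slope between [a] and [x] than between [x] and [b],
which puts its graph at [x] below the chord. *)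
Lemma ln_le_chord a x b : 1 <= a -> a < x -> x <= b ->
  ln x <= ln b - (ln b - ln a) / (Phi b - Phi a) * (Phi b - Phi x).
Proof.
move=> a1 ax; rewrite le_eqVlt => /predU1P[->|xb].
  by rewrite subrr mulr0 subr0.
have a0 : 0 < a by lra.
have x0 : 0 < x by lra.
have [s /andP[as_ sx] sE] := Phi_ln_MVT a0 ax.
have [t /andP[xt tb] tE] := Phi_ln_MVT x0 xb.
have ts : t * pdf t <= s * pdf s by apply: xpdf_nincr; lra.
have Pab : 0 < Phi b - Phi a by rewrite subr_gt0 ltr_Phi; lra.
have lax : 0 <= ln x - ln a by rewrite subr_ge0 ler_ln ?posrE; lra.
have lxb : 0 <= ln b - ln x by rewrite subr_ge0 ler_ln ?posrE; lra.
rewrite lerBrDr -lerBrDl mulrAC ler_pdivrMr//.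
(* Slope on the left at most slope on the right, with denominators cleared. *)
suff : (ln x - ln a) * (Phi b - Phi x) <= (ln b - ln x) * (Phi x - Phi a).
  by nra.
by have := ler_wpM2r (mulr_ge0 lax lxb) ts; rewrite sE tE; lra.
Qed.

(** * The logarithm of the quantile function *)

Lemma ln_Phi_invK x : ln_Phi_inv (Phi x) = ln x.
Proof. by rewrite /ln_Phi_inv Phi_invK. Qed.

Lemma is_derive_Phi_inv x : is_derive (Phi x) 1 Phi_inv (pdf x)^-1.
Proof.
apply: is_derive_inverse (is_derive_Phi x) _; last by rewrite gt_eqF// pdf_gt0.
- by near=> z; exact: Phi_invK.
- by near=> z; exact: continuous_Phi.
Unshelve. all: end_near. Qed.

Lemma derive1_ln_Phi_inv x : 0 < x ->
  derive1 ln_Phi_inv (Phi x) = (x * pdf x)^-1.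
Proof.
move=> x0; rewrite derive1E.
have dln : is_derive (Phi_inv (Phi x)) 1 (@ln R) x^-1.
  by rewrite Phi_invK; exact: is_derive1_ln.
have [_ ->] := is_derive1_comp dln (is_derive_Phi_inv x).
by rewrite invfM mulrC.
Qed.

End StandardNormalCdf.

(** * Maximum of finitely many lines *)

Section MaxLine.
Local Open Scope convex_scope.
Context {R : realType} {N : nat} (pts : 'I_N.+1 -> R).

Lemma line_le_max_line n x : line pts n x <= max_line pts x.
Proof. exact: le_bigmax. Qed.

Lemma max_line_leP x r :
  reflect (forall n, line pts n x <= r) (max_line pts x <= r).
Proof.
apply: (iffP (bigmax_leP _ _ _ _)) => [[_ h] n|h]; first exact: h.
by split=> [|n _]; exact: h.
Qed.

Lemma convex_polyhedron_epigraph_max_line :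
  convex_polyhedron (epigraph (max_line pts)).
Proof.
exists N.+1, (fun n => (line_slope pts n, -1)),
  (fun n => - line_intercept pts n); split => [n|].
  by apply/eqP => -[_ /eqP]; rewrite oppr_eq0 oner_eq0.
apply/seteqP; split => -[x r] /=.
- move=> /max_line_leP h n; have := h n; rewrite /line/=; lra.
- by move=> h; apply/max_line_leP => n; have := h n; rewrite /line/=; lra.
Qed.

Lemma convex_function_max_line :
  convex_function (E := R^o) [set: R^o] (max_line pts).
Proof.
move=> t x y _ _; apply/max_line_leP => n.
have xyE : x <| t |> y = t%:inum * (x : R) + (1 - t%:inum) * (y : R) by [].
have -> : line pts n (x <| t |> y) =
          t%:inum * line pts n x + (1 - t%:inum) * line pts n y.
  by rewrite xyE /line; ring.
by rewrite convRE lerD// ler_wpM2l ?line_le_max_line// subr_ge0.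
Qed.

End MaxLine.

(** * Piecewise linear upper bound *)

Theorem proposition2 (R : realType) (N : nat) (pts : 'I_N.+1 -> R)
    (pts0 : pts ord0 = Phi 1)
    (pts_incr : forall m n : 'I_N.+1, (m < n)%N -> pts m < pts n)
    (pts_lt1 : forall n : 'I_N.+1, pts n < 1)
    (J : finType) (y : J -> R) :
  (forall j : J, 2^-1 < y j -> y j < 1 -> y j <= pts ord_max ->
     ln_Phi_inv (y j) <= max_line pts (y j)) /\
  (convex_polyhedron (epigraph (max_line pts)) /\
   convex_function (E := R^o) [set: R^o] (max_line pts)).
Proof.
split; last first.
  by split; [exact: convex_polyhedron_epigraph_max_line
            |exact: convex_function_max_line].
move=> j y2 y1 ylast.
have [x x0 xE] := Phi_gt0_surj y2 y1.
rewrite -xE in ylast *; rewrite ln_Phi_invK.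
have [x1|x1] := leP x 1.
  apply: le_trans (line_le_max_line pts ord0 _).
  rewrite /line /line_intercept /line_slope eqxx pts0 derive1_ln_Phi_inv//.
  rewrite mul1r ln_Phi_invK ln1.
  by have := ln_le_tangent x0 x1; lra.
have px n : pts n >= Phi 1.
  have [->|n0] := eqVneq n ord0; first by rewrite pts0.
  by rewrite -pts0 ltW// pts_incr// lt0n.
have half1 : 2^-1 < Phi 1 :> R by rewrite -Phi0 ltr_Phi.
have ptsP n : exists2 a, 1 <= a & Phi a = pts n.
  have [a _ aE] := Phi_gt0_surj (lt_le_trans half1 (px n)) (pts_lt1 n).
  by exists a => //; rewrite -ler_Phi aE.
(* By minimality of [n], [pts (n - 1) < Phi x <= pts n]. *)
have [n xn nmin] := @arg_minnP _ ord_max (fun i => Phi x <= pts i) id ylast.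
have n0 : n != ord0.
  by apply: contraTneq xn => ->; rewrite pts0 -ltNge ltr_Phi.
have np : (inord n.-1 : 'I_N.+1) = n.-1 :> nat.
  by apply: inordK; rewrite (leq_ltn_trans (leq_pred _)).
have pred_lt : pts (inord n.-1) < Phi x.
  rewrite ltNge; apply/negP => /nmin; rewrite np leqNgt prednK ?leqnn//.
  by rewrite lt0n.
have [a a1 aE] := ptsP (inord n.-1).
have [b b1 bE] := ptsP n.
rewrite -aE ltr_Phi in pred_lt; rewrite -bE in xn.
have xb : x <= b by rewrite -ler_Phi.
apply: le_trans (line_le_max_line pts n _).
rewrite /line /line_intercept /line_slope (negPf n0) -aE -bE !ln_Phi_invK.
by have := ln_le_chord a1 pred_lt xb; lra.
Qed.
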